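(* For any grid functions $u,v$ (defined on all nodes and ghost nodes), $$h^2\sum_\Gamma(D_kuD_kv)_\Gamma=h\sum_\sigma(uD_{\mathbf n}v)_\sigma-h^2\sum_\Gamma(u\Delta_hv)_\Gamma ,$$ with summation over $k=1,2$ implied. If $v$ vanishes on all boundary nodes, then also $$h^2\sum_\Gamma(\Delta_hu\,\Delta_hv)_\Gamma=h\sum_\sigma(\Delta_hu\,D_{\mathbf n}v)_\sigma+h^2\sum_P(v\,\Delta_h^2u)_P .$$
   Context: The square $[0,L]^2$ is divided uniformly into $N^2$ cells of side $h=L/N$. Node $(l,m)$ is $(lh,mh)$, $0\le l,m\le N$; it is interior if $1\le l,m\le N-1$, otherwise a boundary node. Ghost nodes are $(-1,m),(N+1,m),(l,-1),(l,N+1)$, $0\le l,m\le N$. $\Gamma_{l,m}$ ($0\le l,m\le N-1$) is the cell with lower-left node $(l,m)$. Boundary cells $\sigma$ are the $4N$ grid edges lying on the boundary of the square. $\sum_P$ sums over interior nodes, $\sum_\Gamma$ over all cells, $\sum_\sigma u_\sigma$ over all boundary cells, where $u_\sigma$ is the average of $u$ over the two endpoints of $\sigma$. Discrete normal derivatives: $(D^x_{\mathbf n}v)_{0,m}=\frac{v_{-1,m}-v_{1,m}}{2h}$, $(D^x_{\mathbf n}v)_{N,m}=\frac{v_{N+1,m}-v_{N-1,m}}{2h}$, $(D^y_{\mathbf n}v)_{l,0}=\frac{v_{l,-1}-v_{l,1}}{2h}$, $(D^y_{\mathbf n}v)_{l,N}=\frac{v_{l,N+1}-v_{l,N-1}}{2h}$;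 on a boundary cell, $D_{\mathbf n}$ is $D^x_{\mathbf n}$ if the cell lies on a vertical side and $D^y_{\mathbf n}$ if on a horizontal side. At nodes, $(D_{11}u)_{l,m}=h^{-2}(u_{l-1,m}-2u_{l,m}+u_{l+1,m})$ and $D_{22}$ similarly in $m$; $\Delta_h=D_{11}+D_{22}$; $\Delta_h^2=D_{1111}+2D_{1122}+D_{2222}$ with $D_{1111}=D_{11}D_{11}$, $D_{1122}=D_{11}D_{22}$, $D_{2222}=D_{22}D_{22}$. On a cell, $(D_1uD_1v)_{\Gamma_{l,m}}=\frac1{2h^2}[(u_{l+1,m}-u_{l,m})(v_{l+1,m}-v_{l,m})+(u_{l+1,m+1}-u_{l,m+1})(v_{l+1,m+1}-v_{l,m+1})]$ and $(D_2uD_2v)_{\Gamma_{l,m}}=\frac1{2h^2}[(u_{l,m+1}-u_{l,m})(v_{l,m+1}-v_{l,m})+(u_{l+1,m+1}-u_{l+1,m})(v_{l+1,m+1}-v_{l+1,m})]$. For products of quantities defined at nodes, such as $u\Delta_hv$ or $\Delta_hu\Delta_hv$, the value on $\Gamma$ is the average of the product over the four nodes of $\Gamma$. *)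

(* Defs.v *)
From HB Require Import structures.
From mathcomp Require Import all_boot all_order all_algebra.

Set Implicit Arguments.
Unset Strict Implicit.
Unset Printing Implicit Defensive.

Import Order.TTheory GRing.Theory Num.Theory.
Local Open Scope ring_scope.

(* Nodes and ghost nodes are points (l, m) of int * int with -1 <= l, m <= N + 1.
   A grid function is extended to all of int * int with arbitrary values: the
   operators below, summed over the ranges below, only read it at nodes and at
   the ghost nodes (-1, m), (N + 1, m), (l, -1), (l, N + 1), 0 <= l, m <= N. *)
Definition gridfun (R : Type) : Type := int -> int -> R.

Definition node (N : nat) (l m : int) : bool :=
  (0 <= l <= N%:Z) && (0 <= m <= N%:Z).

Definition interior_node (N : nat) (l m : int) : bool :=
  (1 <= l <= N%:Z - 1) && (1 <= m <= N%:Z - 1).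

Definition boundary_node (N : nat) (l m : int) : bool :=
  node N l m && ~~ interior_node N l m.

Section Operators.
Variables (R : realFieldType) (h : R).
Implicit Types u v w : gridfun R.

Definition gmul u v : gridfun R := fun l m => u l m * v l m.

Definition D11 u : gridfun R := fun l m =>
  (u (l - 1) m - 2 * u l m + u (l + 1) m) / h ^+ 2.

Definition D22 u : gridfun R := fun l m =>
  (u l (m - 1) - 2 * u l m + u l (m + 1)) / h ^+ 2.

Definition laph u : gridfun R := fun l m => D11 u l m + D22 u l m.

Definition D1111 u : gridfun R := D11 (D11 u).
Definition D1122 u : gridfun R := D11 (D22 u).
Definition D2222 u : gridfun R := D22 (D22 u).

Definition bilaph u : gridfun R := fun l m =>
  D1111 u l m + 2 * D1122 u l m + D2222 u l m.

(* A cell is designated by its lower-left node (l, m), 0 <= l, m <= N - 1. *)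
Definition D1D1_cell u v (l m : int) : R :=
  ((u (l + 1) m - u l m) * (v (l + 1) m - v l m)
   + (u (l + 1) (m + 1) - u l (m + 1)) * (v (l + 1) (m + 1) - v l (m + 1)))
  / (2 * h ^+ 2).

Definition D2D2_cell u v (l m : int) : R :=
  ((u l (m + 1) - u l m) * (v l (m + 1) - v l m)
   + (u (l + 1) (m + 1) - u (l + 1) m) * (v (l + 1) (m + 1) - v (l + 1) m))
  / (2 * h ^+ 2).

Definition DkDk_cell u v (l m : int) : R :=
  D1D1_cell u v l m + D2D2_cell u v l m.

Definition cell_avg w (l m : int) : R :=
  (w l m + w (l + 1) m + w l (m + 1) + w (l + 1) (m + 1)) / 4.

Definition sum_cells (N : nat) (F : int -> int -> R) : R :=
  \sum_(l < N) \sum_(m < N) F l%:Z m%:Z.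

Definition sum_interior (N : nat) w : R :=
  \sum_(l < N.+1) \sum_(m < N.+1 | interior_node N l%:Z m%:Z) w l%:Z m%:Z.

(* Outward normal differences; Dnx is meant only at l = 0, N and Dny only at
   m = 0, N. The default value 0 is never used. *)
Definition Dnx (N : nat) v : gridfun R := fun l m =>
  if l == 0 then (v (-1) m - v 1 m) / (2 * h)
  else if l == N%:Z then (v (N%:Z + 1) m - v (N%:Z - 1) m) / (2 * h)
  else 0.

Definition Dny (N : nat) v : gridfun R := fun l m =>
  if m == 0 then (v l (-1) - v l 1) / (2 * h)
  else if m == N%:Z then (v l (N%:Z + 1) - v l (N%:Z - 1)) / (2 * h)
  else 0.

End Operators.

Inductive side := SLeft | SRight | SBottom | STop.

(* The i-th node of a side, 0 <= i <= N; the i-th boundary cell of that side,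
   0 <= i < N, has the nodes i and i + 1 as endpoints. *)
Definition side_node (N : nat) (s : side) (i : int) : int * int :=
  match s with
  | SLeft => (0, i)
  | SRight => (N%:Z, i)
  | SBottom => (i, 0)
  | STop => (i, N%:Z)
  end.

Section Boundary.
Variables (R : realFieldType) (h : R) (N : nat).
Implicit Types v w : gridfun R.

(* The direction of the normal difference is that of the boundary cell, not of
   the node, so at a corner of the square it depends on the cell. *)
Definition Dn (s : side) v : gridfun R :=
  match s with
  | SLeft | SRight => Dnx h N v
  | SBottom | STop => Dny h N v
  end.

Definition bcell_avg (s : side) (i : int) w : R :=
  let p := side_node N s i in
  let q := side_node N s (i + 1) in
  (w p.1 p.2 + w q.1 q.2) / 2.

Definition sum_bcells (F : side -> int -> R) : R :=
  \sum_(s <- [:: SLeft; SRight; SBottom; STop]) \sum_(i < N) F s i%:Z.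

End Boundary.

(* Main.v *)
Require Import Defs.
From HB Require Import structures.
From mathcomp Require Import all_boot all_order all_algebra.
From mathcomp Require Import ring lra zify.

Set Implicit Arguments.
Unset Strict Implicit.
Unset Printing Implicit Defensive.

Import Order.TTheory GRing.Theory Num.Theory.
Local Open Scope ring_scope.

(* On each cell and in each direction, Du Dv + avg (u D^2 v) is exactly the
   difference, across the cell, of the flux u (v_{+1} - v_{-1}) / (2 h^2); the
   first identity follows by telescoping, the flux at the sides of the square
   being the normal difference. Applying it to (D_h u, v) and to (v, D_h u),
   where D_h is the discrete Laplacian, and using the symmetry of D_k u D_k v
   gives the second: the boundary sum of the second application vanishes, and
   its cell average reduces to a sum over interior nodes. *)

(** The common form of the boundary sum over one side and of each direction of a sum of cell
    averages. *)
Definition trapezoid (R : realFieldType) (N : nat) (f : int -> R) : R :=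
  \sum_(i < N) (f i%:Z + f (i%:Z + 1)) / 2.

Section SummationByParts.
Variable R : realFieldType.
Implicit Types (f : int -> R) (u v w : gridfun R) (h : R) (N : nat).

Lemma sum_int_telescope N f :
  \sum_(i < N) (f (i%:Z + 1) - f i%:Z) = f N%:Z - f 0.
Proof.
rewrite -(telescope_sumr (fun i => f i%:Z) (leq0n N)) big_mkord.
by apply: eq_bigr => i _; rewrite -addn1 PoszD.
Qed.

(** Each term is [f i] plus half the increment of [f], and the increments telescope. *)
Lemma trapezoidE N f :
  trapezoid N f = \sum_(i < N.+1) f i%:Z - (f 0 + f N%:Z) / 2.
Proof.
have -> : trapezoid N f
  = \sum_(i < N) (f i%:Z + (f (i%:Z + 1) - f i%:Z) / 2).
  by apply: eq_bigr => i _; field.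
rewrite big_split /= -mulr_suml sum_int_telescope big_ord_recr /=.
by field.
Qed.

Lemma trapezoidB N f g :
  trapezoid N f - trapezoid N g = trapezoid N (fun i => f i - g i).
Proof. by rewrite /trapezoid -sumrB; apply: eq_bigr => i _; field. Qed.

Lemma trapezoidD N f g :
  trapezoid N f + trapezoid N g = trapezoid N (fun i => f i + g i).
Proof. by rewrite /trapezoid -big_split; apply: eq_bigr => i _ /=; field. Qed.

Lemma trapezoidZ N c f : c * trapezoid N f = trapezoid N (fun i => c * f i).
Proof. by rewrite /trapezoid mulr_sumr; apply: eq_bigr => i _; field. Qed.

Lemma eq_trapezoid N f g : f =1 g -> trapezoid N f = trapezoid N g.
Proof. by move=> fg; apply: eq_bigr => i _; rewrite !fg. Qed.

(** The four-node average is the product of the two-point averages in each direction. *)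
Lemma sum_cells_avgE N w :
  sum_cells N (cell_avg w) = trapezoid N (fun l => trapezoid N (w l)).
Proof.
apply: eq_bigr => l _; rewrite trapezoidD mulrC trapezoidZ.
by apply: eq_bigr => m _; rewrite /cell_avg; field.
Qed.

(** This is [h] times [u] times the central difference quotient of [v]; at the sides of the square
    it reads ghost nodes. *)
Definition xflux u v : gridfun R := fun l m =>
  u l m * (v (l + 1) m - v (l - 1) m) / 2.
Definition yflux u v : gridfun R := fun l m =>
  u l m * (v l (m + 1) - v l (m - 1)) / 2.

Lemma sum_cells_xflux N h u v : h != 0 ->
  h ^+ 2 * sum_cells N (fun l m =>
    D1D1_cell h u v l m + cell_avg (gmul u (D11 h v)) l m)
  = trapezoid N (xflux u v N%:Z) - trapezoid N (xflux u v 0).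
Proof.
(* The sum over [l] becomes the inner one, so that each row of cells telescopes in the x
   direction. *)
move=> h0; rewrite /sum_cells exchange_big mulr_sumr trapezoidB.
apply: eq_bigr => m _ /=; rewrite mulr_sumr.
(* The mean flux through the vertical edge at [l] between heights [m] and [m + 1]. *)
pose f l := (xflux u v l m%:Z + xflux u v l (m%:Z + 1)) / 2.
transitivity (f N%:Z - f 0); last by rewrite /f; field.
rewrite -sum_int_telescope; apply: eq_bigr => l _.
rewrite /f /xflux /D1D1_cell /cell_avg /gmul /D11 !addrK.
by field.
Qed.

Lemma sum_cells_yflux N h u v : h != 0 ->
  h ^+ 2 * sum_cells N (fun l m =>
    D2D2_cell h u v l m + cell_avg (gmul u (D22 h v)) l m)
  = trapezoid N (fun l => yflux u v l N%:Z)
    - trapezoid N (fun l => yflux u v l 0).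
Proof.
move=> h0; rewrite /sum_cells mulr_sumr trapezoidB.
apply: eq_bigr => l _ /=; rewrite mulr_sumr.
pose f m := (yflux u v l%:Z m + yflux u v (l%:Z + 1) m) / 2.
transitivity (f N%:Z - f 0); last by rewrite /f; field.
rewrite -sum_int_telescope; apply: eq_bigr => m _.
rewrite /f /yflux /D2D2_cell /cell_avg /gmul /D22 !addrK.
by field.
Qed.

Lemma sum_bcells_flux N h u v : h != 0 -> (0 < N)%N ->
  h * sum_bcells N (fun s i => bcell_avg N s i (gmul u (Dn h N s v)))
  = trapezoid N (xflux u v N%:Z) - trapezoid N (xflux u v 0)
    + (trapezoid N (fun l => yflux u v l N%:Z)
       - trapezoid N (fun l => yflux u v l 0)).
Proof.
(* [Dnx] and [Dny] test for 0 first, so the right and top sides reach their own branch only because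
   [N] is nonzero. *)
move=> h0 N0; have NZ : (N%:Z == 0) = false by case: N N0.
rewrite /sum_bcells !big_cons big_nil addr0 !mulrDr.
have E s f : (forall i, h * gmul u (Dn h N s v) (side_node N s i).1
                            (side_node N s i).2 = f i) ->
    h * \sum_(i < N) bcell_avg N s i%:Z (gmul u (Dn h N s v)) = trapezoid N f.
  move=> Ef; rewrite mulr_sumr; apply: eq_bigr => i _.
  by rewrite -!Ef /bcell_avg; field.
have neg f : - trapezoid N f = trapezoid N (fun i => - f i).
  by rewrite -mulN1r trapezoidZ; apply: eq_trapezoid => i; rewrite mulN1r.
(* On the left and bottom sides the outward normal points in the negative direction, hence the minus
   signs. *)
rewrite !neg (E SLeft (fun m => - xflux u v 0 m)); last first.
  by move=> m; rewrite /= /gmul /Dnx /xflux eqxx sub0r add0r; field.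
rewrite (E SRight (xflux u v N%:Z)); last first.
  by move=> m; rewrite /= /gmul /Dnx /xflux NZ eqxx; field.
rewrite (E SBottom (fun l => - yflux u v l 0)); last first.
  by move=> l; rewrite /= /gmul /Dny /yflux eqxx sub0r add0r; field.
rewrite (E STop (fun l => yflux u v l N%:Z)); last first.
  by move=> l; rewrite /= /gmul /Dny /yflux NZ eqxx; field.
by ring.
Qed.

Lemma discrete_green N h u v : h != 0 -> (0 < N)%N ->
  h ^+ 2 * sum_cells N (DkDk_cell h u v)
  = h * sum_bcells N (fun s i => bcell_avg N s i (gmul u (Dn h N s v)))
    - h ^+ 2 * sum_cells N (cell_avg (gmul u (laph h v))).
Proof.
move=> h0 N0; rewrite sum_bcells_flux // -(sum_cells_xflux N u v h0).
rewrite -(sum_cells_yflux N u v h0).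
rewrite -!mulrDr -mulrBr /sum_cells -!(big_split, sumrB) /=; congr (_ * _).
apply: eq_bigr => l _; rewrite -!(big_split, sumrB) /=.
by apply: eq_bigr => m _; rewrite /DkDk_cell /cell_avg /gmul /laph; ring.
Qed.

Lemma boundary_node_side N s (i : nat) : (i <= N)%N ->
  boundary_node N (side_node N s i%:Z).1 (side_node N s i%:Z).2.
Proof.
by move=> iN; case: s; rewrite /boundary_node /node /interior_node /=; lia.
Qed.

(** Trapezoidal weights differ from 1 only at the ends of the range, where [w] vanishes. *)
Lemma sum_cells_avg_interior N w :
  (forall l m, boundary_node N l m -> w l m = 0) ->
  sum_cells N (cell_avg w) = sum_interior N w.
Proof.
move=> w0.
have side0 s (i : 'I_N.+1) :
    w (side_node N s i%:Z).1 (side_node N s i%:Z).2 = 0.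
  by apply/w0/boundary_node_side; rewrite -ltnS.
(* This includes the columns [l = 0] and [l = N], where the sum on the right is empty and every term
   on the left vanishes. *)
have inner (l : 'I_N.+1) : trapezoid N (w l%:Z)
    = \sum_(m < N.+1 | interior_node N l%:Z m%:Z) w l%:Z m%:Z.
  rewrite trapezoidE (side0 SBottom l) (side0 STop l) addr0 mul0r subr0.
  rewrite [RHS]big_mkcond /=; apply: eq_bigr => m _; case: ifPn => // lm.
  apply: w0; rewrite /boundary_node lm andbT /node.
  by have := ltn_ord l; have := ltn_ord m; lia.
have left0 : trapezoid N (w 0) = 0.
  rewrite trapezoidE big1 => [|m _]; last exact: (side0 SLeft m).
  by rewrite (side0 SLeft ord0) (side0 SLeft ord_max) addr0 mul0r subr0.
have right0 : trapezoid N (w N%:Z) = 0.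
  rewrite trapezoidE big1 => [|m _]; last exact: (side0 SRight m).
  by rewrite (side0 SRight ord0) (side0 SRight ord_max) addr0 mul0r subr0.
rewrite sum_cells_avgE trapezoidE left0 right0 addr0 mul0r subr0.
by apply: eq_bigr => l _; apply: inner.
Qed.

Lemma DkDk_cellC h u v l m : DkDk_cell h u v l m = DkDk_cell h v u l m.
Proof. by rewrite /DkDk_cell /D1D1_cell /D2D2_cell; ring. Qed.

(** [D11] and [D22] commute, so the two mixed terms merge into [2 * D1122]. *)
Lemma laph_laph h u l m : laph h (laph h u) l m = bilaph h u l m.
Proof.
by rewrite /bilaph /laph /D1111 /D1122 /D2222 /D11 /D22; ring.
Qed.

Lemma discrete_green_zero_boundary N h u v : h != 0 -> (0 < N)%N ->
  (forall l m : int, boundary_node N l m -> u l m = 0) ->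
  h ^+ 2 * sum_cells N (DkDk_cell h u v)
  = - (h ^+ 2 * sum_interior N (gmul u (laph h v))).
Proof.
move=> h0 N0 u0; rewrite discrete_green //.
rewrite sum_cells_avg_interior => [|l m /u0 ulm0]; last by rewrite /gmul ulm0 mul0r.
rewrite /sum_bcells big1 ?mulr0 ?sub0r // => s _; apply: big1 => i _.
(* The second endpoint becomes the node of index [i.+1], at most [N], to which [boundary_node_side]
   applies. *)
have i1 : i%:Z + 1 = i.+1%:Z by rewrite -addn1 PoszD.
rewrite /bcell_avg i1 /gmul !u0 ?mul0r ?addr0 ?mul0r //.
- exact: boundary_node_side.
- by apply: boundary_node_side; apply: ltnW.
Qed.

End SummationByParts.

Theorem lemma3p8 (R : realFieldType) (L : R) (N : nat) (h : R)
    (L_gt0 : 0 < L) (N_gt0 : (0 < N)%N) (hE : h = L / N%:R)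
    (u v : gridfun R) :
  h ^+ 2 * sum_cells N (DkDk_cell h u v)
  = h * sum_bcells N (fun s i => bcell_avg N s i (gmul u (Dn h N s v)))
    - h ^+ 2 * sum_cells N (cell_avg (gmul u (laph h v)))
  /\
  ((forall l m : int, boundary_node N l m -> v l m = 0) ->
   h ^+ 2 * sum_cells N (cell_avg (gmul (laph h u) (laph h v)))
   = h * sum_bcells N (fun s i => bcell_avg N s i (gmul (laph h u) (Dn h N s v)))
     + h ^+ 2 * sum_interior N (gmul v (bilaph h u))).
Proof.
have h0 : h != 0 by rewrite hE gt_eqF // divr_gt0 // ltr0n.
split=> [|v0]; first exact: discrete_green.
have green := discrete_green (laph h u) v h0 N_gt0.
have green0 := discrete_green_zero_boundary (laph h u) h0 N_gt0 v0.
have symD : sum_cells N (DkDk_cell h v (laph h u))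
            = sum_cells N (DkDk_cell h (laph h u) v).
  by apply: eq_bigr => l _; apply: eq_bigr => m _; apply: DkDk_cellC.
have bilapE : sum_interior N (gmul v (laph h (laph h u)))
              = sum_interior N (gmul v (bilaph h u)).
  by apply: eq_bigr => l _; apply: eq_bigr => m _; rewrite /gmul laph_laph.
(* Both identities now evaluate the same gradient sum; equating them and solving for the cell
   average of the product of Laplacians is linear. *)
by move: green; rewrite -symD green0 bilapE; lra.
Qed.
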